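(* Let $(X,\tau_1,\tau_2)$ be a bitopological space and let $i,j\in\{1,2\}$ with $i\neq j$. Then $(X,\tau_1,\tau_2)$ is $(\tau_i,\tau_j)$-weakly Lindelöf if and only if its pairwise semiregularization $(X,\tau^s_{(1,2)},\tau^s_{(2,1)})$ is $(\tau^s_{(i,j)},\tau^s_{(j,i)})$-weakly Lindelöf.
   Context: A bitopological space $(X,\tau_1,\tau_2)$ is a set $X$ with two topologies (no separation axioms assumed). For a topology $\sigma$ on $X$, $\sigma\text{-}\mathrm{int}$ and $\sigma\text{-}\mathrm{cl}$ denote interior and closure with respect to $\sigma$. For $i\ne j$ in $\{1,2\}$, a set $S\subseteq X$ is $(\tau_i,\tau_j)$-regular open if $\tau_i\text{-}\mathrm{int}(\tau_j\text{-}\mathrm{cl}(S))=S$. The topology on $X$ generated by the $(\tau_i,\tau_j)$-regular open sets (they are closed under finite intersections and form a base for it) is denoted $\tau^s_{(i,j)}$; the space $(X,\tau^s_{(1,2)},\tau^s_{(2,1)})$ is the pairwise semiregularization of $(X,\tau_1,\tau_2)$. For two topologies $\sigma,\sigma'$ on $X$, the space is $(\sigma,\sigma')$-weakly Lindelöf if for every cover $\{U_\alpha:\alpha\in\Delta\}$ of $X$ by $\sigma$-open sets there is a countable subset $\{\alpha_n:n\in\mathbb{N}\}$ of $\Delta$ with $X=\sigma'\text{-}\mathrm{cl}\left(\bigcup_{n\in\mathbb{N}}U_{\alpha_n}\right)$. *)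

(* Defs.v *)
From HB Require Import structures.
From mathcomp Require Import all_boot all_order all_algebra.
From mathcomp Require Import all_classical topology.

Set Implicit Arguments.
Unset Strict Implicit.
Unset Printing Implicit Defensive.

Local Open Scope classical_set_scope.

(* A topology on [X] is a term of [Topological X], as in [sup_topology]; it is
   packed to apply the library's operators to it. [Topological X] also contains
   a choice operator on [X]: it plays no role here, any type has one classically
   and the operators contained in two topologies on [X] may differ. [X] may be
   empty. *)

Notation "s .-open" := (@open (Topological.Pack s))
  (at level 2, format "s .-open") : classical_set_scope.
Notation "s .-int" := (@interior (Topological.Pack s))
  (at level 2, format "s .-int") : classical_set_scope.
Notation "s .-cl" := (@closure (Topological.Pack s))
  (at level 2, format "s .-cl") : classical_set_scope.

(* The indices 1 and 2 of the two topologies are the elements of ['I_2]. *)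
Definition bitopology (X : Type) : Type := 'I_2 -> Topological X.

Definition regular_open (X : Type) (s t : Topological X) (S : set X) : Prop :=
  s.-int (t.-cl S) = S.

Definition semireg_space (X : Type) (s t : Topological X) : Type := X.

Section Semireg.
Context (X : Type) (s t : Topological X).

HB.instance Definition _ :=
  Choice.copy (semireg_space s t) (Topological.Pack s).
HB.instance Definition _ := isSubBaseTopological.Build (semireg_space s t)
  [set S : set X | regular_open s t S] id.

End Semireg.

(* [semireg tau i j] is the topology tau^s_(i,j) on [X]. *)
Definition semireg (X : Type) (tau : bitopology X) (i j : 'I_2) :
    Topological X :=
  Topological.class (semireg_space (tau i) (tau j)).

Definition weakly_lindelof (X : Type) (s t : Topological X) : Prop :=
  forall (Delta : Type) (U : Delta -> set X),
    (forall a, s.-open (U a)) -> \bigcup_a U a = setT ->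
    exists2 A : set Delta, countable A & t.-cl (\bigcup_(a in A) U a) = setT.

(* Main.v *)
Require Import Defs.
From mathcomp Require Import all_boot all_classical topology.

Local Open Scope classical_set_scope.

(** Write [s], [t] for the two topologies and [s'], [t'] for the corresponding
    semiregularizations. They are coarser: [s'] is contained in [s] and [t'] in
    [t] ([semireg_coarser]). Weak Lindelofness therefore passes from [(s, t)] to
    [(s', t')]: a cover by [s']-open sets is a cover by [s]-open sets, and a
    [t]-dense union is [t']-dense.

    Conversely, an [s]-open cover [U] is enlarged to the cover by the sets
    [V a = s.-int (t.-cl (U a))], which are regular open, hence [s']-open. The
    hypothesis gives countably many of them with [t']-dense union, and it
    remains to return from the [V a] to the [U a] and from [t'] to [t]. This is
    [semireg_dense]: a nonempty [t]-open set [G] can itself be enlarged to the nonempty [t']-open set [t.-int (s.-cl G)],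
    which meets some [V a]; since [V a] is [s]-open it meets [G], and since [G]
    is [t]-open it meets [U a]. *)

(** Density only quantifies over open sets, so that, unlike the equation on
    closures, it can be compared between two topologies by comparing their
    open sets. *)
Lemma closure_setTP (T : topologicalType) (A : set T) :
  closure A = setT <-> dense A.
Proof.
split=> [clA O [x Ox] oO|dA].
  have: closure A x by rewrite clA.
  by rewrite setIC; apply; exact: open_nbhs_nbhs.
rewrite -subTset => x _ B; rewrite nbhsE => -[O [oO Ox] OB].
have [|y [Oy Ay]] := dA O _ oO; first by exists x.
by exists y; split=> //; exact: OB.
Qed.

Lemma open_meets_closure (T : topologicalType) (G A : set T) :
  open G -> G `&` closure A !=set0 -> G `&` A !=set0.
Proof.
by move=> oG [x [Gx /(_ G)]]; rewrite setIC; apply; exact: open_nbhs_nbhs.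
Qed.

Section Semireg.
Context (X : Type) (s t : Topological X).
Implicit Types S : set X.

Lemma sub_int_cl S : s.-open S -> S `<=` s.-int (t.-cl S).
Proof.
move=> oS; rewrite -(@open_subsetE (Topological.Pack s)) //.
exact: (@subset_closure (Topological.Pack t)).
Qed.

(** The operator [s.-int \o t.-cl] is idempotent, as for a single topology: one
    inclusion is [sub_int_cl] for the [s]-open set [s.-int (t.-cl S)], the other
    is monotonicity and the idempotence of [t.-cl]. *)
Lemma regular_open_int_cl S : regular_open s t (s.-int (t.-cl S)).
Proof.
rewrite /regular_open eqEsubset; split; last first.
  by apply: sub_int_cl; exact: (@open_interior (Topological.Pack s)).
apply: (@interiorS (Topological.Pack s)).
rewrite [X in _ `<=` X]((@closure_id (Topological.Pack t) _).1 _).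
  apply: (@closureS (Topological.Pack t)).
  exact: (@interior_subset (Topological.Pack s)).
exact: (@closed_closure (Topological.Pack t)).
Qed.

Lemma regular_open_semireg S :
  regular_open s t S -> (Topological.class (semireg_space s t)).-open S.
Proof.
move=> rS; exists [set S]; last by rewrite bigcup_set1.
by move=> _ ->; exact: (@finI_from1 _ _ _ id).
Qed.

(** Regular open sets are [s]-interiors, and the topology that they generate
    consists of unions of finite intersections of them. *)
Lemma semireg_coarser S :
  (Topological.class (semireg_space s t)).-open S -> s.-open S.
Proof.
move=> [D DI <-]; apply: (@bigcup_open (Topological.Pack s)) => _ /DI [F FR <-].
apply/(@interior_id (Topological.Pack s)); rewrite eqEsubset; split.
  exact: (@interior_subset (Topological.Pack s)).
(* Neighborhoods of a point form a filter, hence are stable under finite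
   intersections. *)
move=> x Fx; apply: (@filter_bigI _ _ _ _ (@nbhs _ (Topological.Pack s) x)).
move=> S' S'F; apply: (@open_nbhs_nbhs (Topological.Pack s)).
split; last exact: Fx.
have /set_mem /= <- := FR _ S'F.
exact: (@open_interior (Topological.Pack s)).
Qed.

End Semireg.

(** The sets [s.-int (t.-cl (U a))] may be much larger than [U a] and
    [semireg_space t s] has fewer open sets to test density with, but the two
    losses compensate. The two closures are removed in turn, first the
    [s]-closure of the test set [G], because [s.-int (t.-cl (U a))] is [s]-open,
    then the [t]-closure of [U a], because [G] is [t]-open. *)
Lemma semireg_dense (X : Type) (s t : Topological X) (I : Type) (A : set I)
    (U : I -> set X) :
  @dense (Topological.Pack (Topological.class (semireg_space t s)))
    (\bigcup_(a in A) s.-int (t.-cl (U a))) ->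
  @dense (Topological.Pack t) (\bigcup_(a in A) U a).
Proof.
move=> dV G [x Gx] oG.
have oH :=
  regular_open_semireg _ _ _ _ (regular_open_int_cl _ t s G).
have [|y [Hy [a Aa Vy]]] := dV _ _ oH.
  by exists x; exact: sub_int_cl.
have [|z [Vz Gz]] := @open_meets_closure (Topological.Pack s)
    (s.-int (t.-cl (U a))) G (@open_interior (Topological.Pack s) _).
  by exists y; split=> //; exact: (@interior_subset (Topological.Pack t)).
have [|w [Gw Uw]] := @open_meets_closure (Topological.Pack t) G (U a) oG.
  by exists z; split=> //; exact: (@interior_subset (Topological.Pack s)).
by exists w; split=> //; exists a.
Qed.

Theorem theorem4p5 (X : Type) (tau : bitopology X) (i j : 'I_2)
    (hij : i != j) :
  weakly_lindelof (tau i) (tau j) <->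
  weakly_lindelof (semireg tau i j) (semireg tau j i).
Proof.
split=> wL Delta U oU cU.
  have [a|A cA dA] := wL Delta U _ cU; first exact: semireg_coarser (oU a).
  exists A => //; apply/closure_setTP => O O0 /semireg_coarser oO.
  by move/closure_setTP: dA; exact.
pose V a := (tau i).-int ((tau j).-cl (U a)).
have oV a : (semireg tau i j).-open (V a).
  exact/regular_open_semireg/regular_open_int_cl.
have cV : \bigcup_a V a = setT.
  by rewrite -subTset -cU; apply: subset_bigcup => a _; exact: sub_int_cl.
have [A cA /closure_setTP dA] := wL Delta V oV cV.
by exists A => //; apply/closure_setTP; exact: semireg_dense dA.
Qed.
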